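(* Let $(X,\mathfrak M,\mu)$ be a measure space with a doubling ball-basis $\mathfrak B$ (with constants $\mathcal K$ and $\eta$), and let $f,g$ be measurable functions such that $f$ is strongly dominated by $g$. Then for any ball $B\in\mathfrak B$ $$\mu\{x\in B:\ |f(x)-m_f(B)|>\lambda|g(x)|\}\le C\exp(-c\cdot\lambda)\,\mu(B),\qquad \lambda>0,$$ where $m_f(B)$ is a median of $f$ over $B$ and $C,c>0$ are admissible constants, i.e. constants depending only on $\mathcal K$ and $\eta$.
   Context: Let $(X,\mathfrak M,\mu)$ be a measure space. A family $\mathfrak B\subset\mathfrak M$ is a ball-basis (its members are called balls) if: (B1) $0<\mu(B)<\infty$ for every $B\in\mathfrak B$; (B2) for any $x,y\in X$ there is a ball $B$ containing both $x$ and $y$; (B3) for every $E\in\mathfrak M$ and $\varepsilon>0$ there is a finite or infinite sequence of balls $B_k$ with $\mu(E\,\triangle\,\bigcup_kB_k)<\varepsilon$; (B4) for every $B\in\mathfrak B$ there is a ball $B^*\in\mathfrak B$ (the hull of $B$) with $\bigcup_{A\in\mathfrak B:\ \mu(A)\le 2\mu(B),\ A\cap B\ne\varnothing}A\subset B^*$ and $\mu(B^* )\le\mathcal K\mu(B)$, where $\mathcal K$ is a positive constant. The ball-basis is doubling if there is a constant $\eta>2$ such that for every ball $A$ with $\mu(A)<\mu(X)/2$ there is a ball $B\supset A$ with $2\mu(A)\le\mu(B)\le\eta\,\mu(A)$. For a measurable function $f$, a set $E$, a ball $B$ and $0<\alpha<1$: $\mathrm{OSC}_E(f)=\sup_{x,x'\in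 E}|f(x)-f(x')|$; $\mathrm{OSC}_{B,\alpha}(f)=\inf\{\mathrm{OSC}_E(f):\ E\subset B,\ \mu(E)\ge\alpha\mu(B)\}$; $\mathrm{INF}_B(g)=\operatorname{ess\,inf}_{y\in B}|g(y)|$. $f$ is strongly dominated by $g$ if for every $0<\alpha<1$ there is a number $\beta=\beta(\alpha)>0$ such that $\mathrm{OSC}_{B,\alpha}(f)<\beta\cdot\mathrm{INF}_B(g)$ for every ball $B\in\mathfrak B$. A median $m_f(B)$ of a measurable function $f$ over a ball $B$ is a real number (possibly not unique) with $\mu\{x\in B: f(x)>m_f(B)\}\le\mu(B)/2$ and $\mu\{x\in B: f(x)<m_f(B)\}\le\mu(B)/2$.
   Formalization: The constant c may depend on the domination function β(α) as well as on K and η (C depends only on K and η); with c independent of β the claim fails, since strong domination is invariant under replacing f by tf and β by tβ. *)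

(* Defs.v *)
From HB Require Import structures.
From mathcomp Require Import all_boot all_order all_algebra.
From mathcomp Require Import all_classical all_reals all_analysis.
From mathcomp Require Import ess_sup_inf.

Set Implicit Arguments.
Unset Strict Implicit.
Unset Printing Implicit Defensive.

Import Order.TTheory GRing.Theory Num.Theory.
Import numFieldNormedType.Exports.

Local Open Scope classical_set_scope.
Local Open Scope ring_scope.
Local Open Scope ereal_scope.

(* In [bb_approx] the index set [D] is an arbitrary set of naturals, so that
   [Bk] restricted to [D] is a finite (possibly empty) or infinite sequence.
   `+` is the symmetric difference of sets. *)
Record ball_basis (R : realType) (d : measure_display) (T : measurableType d)
    (mu : {measure set T -> \bar R}) (K : R) (Bs : set (set T)) : Prop := {
  bb_measurable : forall B, Bs B -> measurable B;
  bb_measure : forall B, Bs B -> 0 < mu B < +oo;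
  bb_join : forall x y : T, exists B, [/\ Bs B, B x & B y];
  bb_approx : forall (E : set T) (e : R), measurable E -> (0 < e)%R ->
    exists (D : set nat) (Bk : nat -> set T),
      (forall k, D k -> Bs (Bk k)) /\
      mu (E `+` \bigcup_(k in D) Bk k) < e%:E;
  bb_hull : forall B, Bs B -> exists Bstar,
    [/\ Bs Bstar,
        \bigcup_(A in [set A | [/\ Bs A, mu A <= 2%:E * mu B & A `&` B !=set0]])
          A `<=` Bstar
      & mu Bstar <= K%:E * mu B] }.

Definition doubling (R : realType) (d : measure_display) (T : measurableType d)
    (mu : {measure set T -> \bar R}) (eta : R) (Bs : set (set T)) : Prop :=
  forall A, Bs A -> mu A < mu setT * (2^-1)%:E ->
    exists B, [/\ Bs B, A `<=` B, 2%:E * mu A <= mu B & mu B <= eta%:E * mu A].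

Definition OSC (R : realType) (T : Type) (E : set T) (f : T -> R) : \bar R :=
  ereal_sup [set `|f p.1 - f p.2|%:E | p in E `*` E].

Definition OSC_ball (R : realType) (d : measure_display) (T : measurableType d)
    (mu : {measure set T -> \bar R}) (B : set T) (a : R) (f : T -> R) : \bar R :=
  ereal_inf [set OSC E f | E in
    [set E | [/\ measurable E, E `<=` B & a%:E * mu B <= mu E]]].

Definition INF (R : realType) (d : measure_display) (T : measurableType d)
    (mu : {measure set T -> \bar R}) (B : set T) (mB : measurable B)
    (g : T -> R) : \bar R :=
  ess_inf (mrestr mu mB) (fun y => `|g y|%:E).

(* The domination function [beta] is a parameter because domination by [g] is
   invariant under [f |-> t * f] (with [beta |-> t * beta]), so that the rate of
   an exponential estimate for [f] against [g] has to depend on it. *)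
Definition strongly_dominated (R : realType) (d : measure_display)
    (T : measurableType d) (mu : {measure set T -> \bar R}) (Bs : set (set T))
    (beta : R -> R) (f g : T -> R) : Prop :=
  forall a : R, (0 < a < 1)%R -> (0 < beta a)%R /\
    forall (B : set T) (mB : measurable B), Bs B ->
      OSC_ball mu B a f < (beta a)%:E * INF mu mB g.

Definition is_median (R : realType) (d : measure_display) (T : measurableType d)
    (mu : {measure set T -> \bar R}) (f : T -> R) (B : set T) (m : R) : Prop :=
  mu [set x | B x /\ (m < f x)%R] <= mu B * (2^-1)%:E /\
  mu [set x | B x /\ (f x < m)%R] <= mu B * (2^-1)%:E.

(* Main.v *)
(* Fix [a] close to 1. Strong domination gives every ball [H] a core
   [E] of measure at least [a * mu H] on which [f] oscillates by at most
   [beta a * `|g x|], for almost every [x] in [H]. Let [B] be a ball with hull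
   [H]. The part of [B] outside the core of [H] is covered, up to a set of
   arbitrarily small measure, by the hulls of finitely many disjoint balls [A]
   of total measure a small multiple of [mu B]. Each [A] is the last ball of a
   chain of doublings in which [H] minus its core has density above a threshold.
   That density in [A] is then still small, so the core of [H] meets the core
   of the second hull of [A]. Since [g x] controls the oscillation on the core
   of every ball containing [x], iterating [n] times shows that [f] differs on
   [B] from its values on the core of [H] by at most [n * beta a * `|g x|],
   except on a set of measure at most [2 ^- n * mu B]. *)
Require Import Defs.
From HB Require Import structures.
From mathcomp Require Import all_boot all_order all_algebra.
From mathcomp Require Import all_classical all_reals all_analysis.
From mathcomp Require Import ess_sup_inf measurable_realfun ring lra.

Set Implicit Arguments.
Unset Strict Implicit.
Unset Printing Implicit Defensive.

Import Order.TTheory GRing.Theory Num.Theory.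
Import numFieldNormedType.Exports.

Local Open Scope classical_set_scope.
Local Open Scope ring_scope.

(** * Real-valued calculus of sets of finite measure *)

Section FiniteMeasure.
Context {R : realType} {d : measure_display} {T : measurableType d}.
Variable mu : {measure set T -> \bar R}.
Implicit Types (A B F : set T) (s : seq (set T)).

Definition finite_meas A := measurable A /\ (mu A < +oo)%E.
(** Real values make linear arithmetic available. As [fine] sends [+oo] to 0, [finite_meas] has to
    be carried along. *)
Definition rmeas A : R := fine (mu A).

Lemma rmeasE A : finite_meas A -> mu A = (rmeas A)%:E.
Proof. by move=> [mA fA]; rewrite /rmeas fineK// ge0_fin_numE. Qed.

Lemma rmeas_ge0 A : 0 <= rmeas A.
Proof. exact: fine_ge0. Qed.

Lemma finite_meas_sub A B :
  measurable A -> finite_meas B -> A `<=` B -> finite_meas A.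
Proof.
move=> mA [mB fB] AB; split=> //; apply: le_lt_trans fB.
by apply: le_measure; rewrite ?inE.
Qed.

Lemma rmeas_le A B :
  measurable A -> finite_meas B -> A `<=` B -> rmeas A <= rmeas B.
Proof.
move=> mA fB AB; have fA := finite_meas_sub mA fB AB.
rewrite -lee_fin -!rmeasE//; apply: le_measure; rewrite ?inE//.
by case: fB.
Qed.

Lemma finite_measI A B : finite_meas A -> measurable B -> finite_meas (A `&` B).
Proof.
move=> fA mB; apply: (finite_meas_sub _ fA) => //; apply: measurableI => //.
by case: fA.
Qed.

Lemma finite_measD A B : finite_meas A -> measurable B -> finite_meas (A `\` B).
Proof.
move=> fA mB; apply: (finite_meas_sub _ fA) => //; apply: measurableD => //.
by case: fA.
Qed.

Lemma rmeasDI A B : finite_meas A -> measurable B ->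
  rmeas A = rmeas (A `\` B) + rmeas (A `&` B).
Proof.
move=> fA mB; apply: EFin_inj; rewrite EFinD -!rmeasE//; last 2 first.
- exact: finite_measI.
- exact: finite_measD.
by apply: measureDI => //; case: fA.
Qed.

Lemma finite_measU A B : finite_meas A -> finite_meas B ->
  finite_meas (A `|` B) /\ rmeas (A `|` B) <= rmeas A + rmeas B.
Proof.
move=> fA fB; have [mA mB] := (fA.1, fB.1).
have mU : measurable (A `|` B) by exact: measurableU.
have leU : (mu (A `|` B) <= mu A + mu B)%E by exact: measureU2.
have fU : finite_meas (A `|` B).
  by split=> //; apply: le_lt_trans leU _; rewrite !rmeasE// -EFinD ltry.
by split=> //; rewrite -lee_fin EFinD -!rmeasE.
Qed.

Lemma finite_meas0 : finite_meas set0.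
Proof. by split=> //; rewrite measure0. Qed.

Lemma finite_meas_bigcup s (F : set T -> set T) :
  (forall A, A \in s -> finite_meas (F A)) ->
  finite_meas (\bigcup_(A in [set` s]) F A) /\
  rmeas (\bigcup_(A in [set` s]) F A) <= \sum_(A <- s) rmeas (F A).
Proof.
rewrite bigcup_seq; elim: s => [_|A s IH fs].
  by rewrite !big_nil /rmeas measure0; split=> //; exact: finite_meas0.
rewrite !big_cons.
have /IH[fs' les] : forall B, B \in s -> finite_meas (F B).
  by move=> B Bs; apply: fs; rewrite inE Bs orbT.
have [fU leU] := finite_measU (fs A (mem_head A s)) fs'.
by split=> //; apply: le_trans leU _; rewrite lerD2l.
Qed.

Definition disjoint_seq s := pairwise (fun A B => `[< A `&` B = set0 >]) s.

(** Induction on [s], replacing [F] by [F] minus the head set: by disjointness, the traces of the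
    other sets on [F] do not change. *)
Lemma sum_disjoint_le s F : disjoint_seq s ->
  (forall A, A \in s -> measurable A) -> finite_meas F ->
  \sum_(A <- s) rmeas (F `&` A) <= rmeas F.
Proof.
elim: s F => [|A s IH] F; first by rewrite big_nil rmeas_ge0.
rewrite /disjoint_seq/= => /andP[/allP dA ds] ms fF; rewrite big_cons.
have mA : measurable A by apply: ms; rewrite mem_head.
rewrite (rmeasDI fF mA) addrC lerD2r.
have -> : \sum_(B <- s) rmeas (F `&` B) = \sum_(B <- s) rmeas ((F `\` A) `&` B).
  apply: eq_big_seq => B /dA /asboolP AB; congr rmeas.
  apply/seteqP; split=> x [] => [Fx Bx|[Fx _] Bx]//.
  split=> //; split=> // Ax.
  by have : (A `&` B) x by []; rewrite AB.
apply: IH => //; last exact: finite_measD.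
by move=> B Bs; apply: ms; rewrite inE Bs orbT.
Qed.

End FiniteMeasure.

(** * Hulls, Vitali covering and approximation by balls *)

Section Balls.
Context {R : realType} {d : measure_display} {T : measurableType d}.
Variables (mu : {measure set T -> \bar R}) (K : R) (Bs : set (set T)).
Hypothesis bb : ball_basis mu K Bs.
Local Notation rm := (rmeas mu).
Implicit Types (A B E F H : set T) (s : seq (set T)).

Lemma ball_finite B : Bs B -> finite_meas mu B.
Proof.
by move=> bB; split; [exact: (bb_measurable bb bB) | case/andP: (bb_measure bb bB)].
Qed.

Lemma ball_meas B : Bs B -> measurable B.
Proof. by move=> /ball_finite[]. Qed.

Lemma ball_gt0 B : Bs B -> 0 < rm B.
Proof.
move=> bB; rewrite -lte_fin -rmeasE; last exact: ball_finite.
by case/andP: (bb_measure bb bB).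
Qed.

Lemma ball_nonempty B : Bs B -> B !=set0.
Proof.
move=> bB; apply/set0P/eqP => B0; have := ball_gt0 bB.
by rewrite B0 /rmeas measure0 ltxx.
Qed.

Definition is_hull B H := [/\ Bs H,
  forall A, Bs A -> rm A <= 2 * rm B -> A `&` B !=set0 -> A `<=` H
  & rm H <= K * rm B].

Lemma hull_exists : exists h : set T -> set T, forall B, Bs B -> is_hull B (h B).
Proof.
suff /choice[h hh] : forall B, exists H, Bs B -> is_hull B H by exists h.
move=> B.
have [bB|nB] := pselect (Bs B); last by exists B.
have [H [bH sH leH]] := bb_hull bb bB; exists H => _; split=> //.
  move=> A bA leA AB x Ax; apply: sH; exists A => //; split=> //.
  by rewrite !rmeasE; [rewrite -EFinM lee_fin|exact: ball_finite..].
by rewrite -lee_fin EFinM -!rmeasE; [|exact: ball_finite..].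
Qed.

Lemma hull_sub B H : Bs B -> is_hull B H -> B `<=` H.
Proof.
move=> bB [_ + _]; apply=> //.
  by have := ball_gt0 bB; lra.
by rewrite setIid; exact: ball_nonempty.
Qed.

(* Selecting greedily in decreasing order of measure: the list is sorted
   increasingly, so the induction adds the smallest ball last. *)
Lemma vitali_sorted s : sorted (fun A B => rm A <= rm B) s ->
  (forall A, A \in s -> Bs A) ->
  exists s', [/\ {subset s' <= s}, disjoint_seq s' &
    forall A, A \in s ->
      exists B, [/\ B \in s', rm A <= rm B & A `&` B !=set0]].
Proof.
elim: s => [_ _|A s IH]; first by exists [::].
rewrite /= path_sortedE; last by move=> ? ? ?; exact: le_trans.
move=> /andP[/allP minA srt] bs.
have /(IH srt)[s' [subs' ds' cs']] : forall B, B \in s -> Bs B.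
  by move=> B Bin; apply: bs; rewrite inE Bin orbT.
have bA : Bs A by apply: bs; rewrite mem_head.
have [[B [Bin AB]]|nAB] := pselect (exists B, B \in s' /\ A `&` B !=set0).
  exists s'; split=> // [C /subs' Cs|C]; first by rewrite inE Cs orbT.
  rewrite inE => /orP[/eqP->|/cs'//].
  by exists B; split=> //; apply: minA; exact: subs'.
exists (A :: s'); split=> [C|/=|C].
- by rewrite !inE => /orP[->//|/subs' ->]; rewrite orbT.
- apply/andP; split=> //; apply/allP => B Bin; apply/asboolP.
  by apply: contrapT => /eqP/set0P ?; apply: nAB; exists B.
rewrite inE => /orP[/eqP->|/cs' [B [Bin leB CB]]].
  by exists A; rewrite mem_head lexx setIid; split=> //; exact: ball_nonempty.
by exists B; rewrite inE Bin orbT.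
Qed.

(** Each ball of [s] meets a selected ball [B] of at least its own measure, so the hull of [B]
    contains it. *)
Lemma vitali s h : (forall A, A \in s -> Bs A) ->
  (forall B, Bs B -> is_hull B (h B)) ->
  exists s', [/\ {subset s' <= s}, disjoint_seq s' &
    \bigcup_(A in [set` s]) A `<=` \bigcup_(A in [set` s']) h A].
Proof.
move=> bs hh; pose le A B := rm A <= rm B.
have ms A : (A \in sort le s) = (A \in s) by rewrite mem_sort.
have [||s' [ss' ds' cs']] := @vitali_sorted (sort le s).
- by apply: sort_sorted => A B; exact: le_total.
- by move=> A; rewrite ms; exact: bs.
exists s'; split=> // [A /ss'|x [A /= As Ax]]; first by rewrite ms.
have [|B [Bs' leAB AB]] := cs' A; first by rewrite ms.
have bB : Bs B by apply: bs; rewrite -ms; exact: ss'.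
have [_ hB _] := hh _ bB; exists B => //; apply: (hB A) => //; first exact: bs.
by have := ball_gt0 bB; lra.
Qed.

(** The approximating sequence of balls may be infinite. Its truncations [W N] exhaust its union
    [V], so by continuity from above some [N] already leaves less than [e] of [E] uncovered. *)
Lemma finite_approx E e : finite_meas mu E -> 0 < e ->
  exists s, [/\ forall A, A \in s -> Bs A,
    rm (E `\` \bigcup_(A in [set` s]) A) <= e &
    rm (\bigcup_(A in [set` s]) A `\` E) <= e].
Proof.
move=> fE e0; have e20 : 0 < e / 2 by lra.
have [D [A [bA sdA]]] := bb_approx bb fE.1 e20.
pose V := \bigcup_(k in D) A k.
have mV : measurable V.
  rewrite /V; apply: bigcup_measurable => k Dk; exact/ball_meas/bA.
pose W N := \bigcup_(k in D `&` `I_N) A k.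
have mW N : measurable (W N).
  by apply: bigcup_measurable => k [Dk _]; exact/ball_meas/bA.
have WV N : W N `<=` V by move=> x [k [Dk _] Ax]; exists k.
pose G N := E `\` W N.
have mG N : measurable (G N) by apply: measurableD => //; exact: fE.1.
have capG : \bigcap_N G N = E `\` V.
  apply/seteqP; split=> [x Gx|x [Ex Vx] N _]; last first.
    by split=> // /WV.
  split; first by have [] := Gx 0%N I.
  (* [W N] uses only indices below [N], so the ball of index [k] is present from [k.+1] on. *)
  move=> [k Dk Ax]; have [_] := Gx k.+1 I; apply; exists k => //.
  by split=> //=.
have mEV : measurable (E `+` V).
  by apply: measurableU; apply: measurableD => //; exact: fE.1.
have fsd : finite_meas mu (E `+` V).
  by split=> //; apply: lt_trans sdA _; rewrite ltry.
have lesd : rm (E `+` V) < e / 2 by rewrite -lte_fin -rmeasE.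
have EV : rm (E `\` V) < e / 2.
  apply: le_lt_trans lesd; apply: rmeas_le => //.
    by apply: measurableD => //; exact: fE.1.
  by move=> x ?; left.
have cvgG : (mu \o G @ \oo --> mu (\bigcap_N G N))%E.
  apply: nonincreasing_cvg_mu => //.
  - apply: le_lt_trans fE.2; apply: le_measure; rewrite ?inE//; first exact: fE.1.
    by move=> x [].
  - by apply: bigcapT_measurable.
  move=> m n mn; apply/subsetPset => x [Ex nW]; split=> // -[k [Dk /= km] Ax].
  by apply: nW; exists k => //; split=> //=; exact: leq_trans mn.
have [N GN] : exists N, (mu (G N) < e%:E)%E.
  have : nbhs (mu (\bigcap_N G N)) [set y | (y < e%:E)%E].
    apply: open_nbhs_nbhs; split; first exact: open_ereal_lt_ereal.
    rewrite /= capG rmeasE; last exact: finite_measD.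
    by rewrite lte_fin; lra.
  by move=> /cvgG[N _ /(_ N (leqnn _))]; exists N.
exists [seq A k | k <- iota 0 N & `[< D k >]].
have WE : \bigcup_(B in [set` [seq A k | k <- iota 0 N & `[< D k >]]]) B = W N.
  apply/seteqP; split=> [x [B /= /mapP[k]]|x [k [Dk /= kN] Ax]].
    rewrite mem_filter mem_iota add0n => /andP[/asboolP Dk kN] -> Ax.
    by exists k.
  exists (A k) => //=; apply/mapP; exists k => //.
  by rewrite mem_filter mem_iota add0n; apply/andP; split=> //; exact/asboolP.
rewrite WE; split=> [B /mapP[k]||].
- by rewrite mem_filter => /andP[/asboolP Dk _] ->; exact: bA.
- by rewrite -lee_fin -rmeasE ?ltW//; apply: finite_measD.
apply: le_trans (_ : rm (E `+` V) <= e); last by lra.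
apply: rmeas_le => //; first by apply: measurableD => //; exact: fE.1.
by move=> x [/WV Vx nEx]; right.
Qed.

(** Start from a finite approximation of [E] and discard the balls of density at most [eps]. A
    discarded ball has a proportion at least [1 - eps] outside [E], where the approximation has
    little mass, so by Vitali the discarded balls lie in hulls of small total measure. *)
Lemma dense_balls E eps e : 0 < K -> finite_meas mu E -> 0 < eps < 1 -> 0 < e ->
  exists s, [/\ forall A, A \in s -> Bs A,
    forall A, A \in s -> eps * rm A < rm (E `&` A) &
    rm (E `\` \bigcup_(A in [set` s]) A) <= e].
Proof.
move=> K0 fE /andP[eps0 eps1] e0.
(* For a discarded ball [A], [rm (h A) <= K * rm A <= q * rm (A \ E)]. The next choice makes
   [e' + q * e'] equal to [e]. *)
pose q := K / (1 - eps); have q0 : 0 < q by apply: divr_gt0 => //; lra.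
pose e' := e / (1 + q); have e'0 : 0 < e' by apply: divr_gt0 => //; lra.
have [s [bs sE sE']] := finite_approx fE e'0.
pose good A := eps * rm A < rm (E `&` A).
exists [seq A <- s | good A].
split=> [A|A|]; first by rewrite mem_filter => /andP[_ /bs].
  by rewrite mem_filter => /andP[].
have [h hh] := hull_exists.
pose bad := [seq A <- s | ~~ good A].
have bbad A : A \in bad -> Bs A by rewrite mem_filter => /andP[_ /bs].
have [s' [ss' ds' cs']] := vitali bbad hh.
have bs' A : A \in s' -> Bs A by move=> /ss'/bbad.
pose U := \bigcup_(A in [set` s]) A.
have fU : finite_meas mu U.
  by have /finite_meas_bigcup[] := fun A As => ball_finite (bs A As).
have /finite_meas_bigcup[fH leH] : forall A, A \in s' -> finite_meas mu (h A).
  by move=> A /bs'/hh[+ _ _]; exact: ball_finite.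
have leb : \sum_(A <- s') rm (h A) <= q * rm (U `\` E).
  apply: (@le_trans _ _ (q * \sum_(A <- s') rm ((U `\` E) `&` A))).
    rewrite mulr_sumr !big_seq; apply: ler_sum => A As'.
    have bA := bs' _ As'; have [_ _ leK] := hh _ bA.
    have := ss' _ As'; rewrite mem_filter => /andP[nA As].
    have UEA : (U `\` E) `&` A = A `\` E.
      apply/seteqP; split=> [x [[]]|x [Ax nEx]]//.
      by split=> //; split=> //; exists A.
    rewrite UEA; have := rmeasDI (ball_finite bA) fE.1.
    rewrite setIC => eqA.
    move: nA; rewrite /good -leNgt => nA.
    apply: le_trans leK _; rewrite /q -mulrA ler_pM2l// ler_pdivlMl; last by lra.
    by lra.
  rewrite ler_pM2l//; apply: sum_disjoint_le => //.
    by move=> A /bs'/ball_meas.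
  by apply: finite_measD => //; exact: fE.1.
have sub : E `\` \bigcup_(A in [set` [seq A <- s | good A]]) A `<=`
    (E `\` U) `|` \bigcup_(A in [set` s']) h A.
  move=> x [Ex nx]; have [[A /= As Ax]|nU] := pselect (U x); last by left.
  right; apply: cs'; exists A => //=; rewrite mem_filter As andbT.
  by apply/negP => gA; apply: nx; exists A => //=; rewrite mem_filter gA.
have mU := fU.1.
have [fEU leEU] := finite_measU (finite_measD fE mU) fH.
have mG : measurable (\bigcup_(A in [set` [seq A <- s | good A]]) A).
  apply: fin_bigcup_measurable; first exact: finite_seq.
  by move=> A /=; rewrite mem_filter => /andP[_ /bs/ball_meas].
have := rmeas_le (measurableD fE.1 mG) fEU sub.
move=> /le_trans; apply; apply: le_trans leEU _.
have le3 : q * rm (U `\` E) <= q * e' by rewrite ler_pM2l.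
have -> : e = e' + q * e' by rewrite /e'; field; lra.
rewrite /U in sE sE' le3 leb *; lra.
Qed.
End Balls.

(** * Calderon-Zygmund selection and cores of balls *)

Section Selection.
Context {R : realType} {d : measure_display} {T : measurableType d}.
Variables (mu : {measure set T -> \bar R}) (K eta : R) (Bs : set (set T)).
Hypotheses (bb : ball_basis mu K Bs) (db : doubling mu eta Bs).
Hypothesis K0 : 0 < K.
Local Notation rm := (rmeas mu).
Implicit Types (A B E F G H : set T) (s : seq (set T)).

(** The ball [B] certifies that [mu A] is below half of the total measure, finite or not, so
    doubling applies to [A]. *)
Lemma doubling_ball A B : Bs A -> Bs B -> 2 * rm A < rm B ->
  exists A', [/\ Bs A', A `<=` A', 2 * rm A <= rm A' & rm A' <= eta * rm A].
Proof.
move=> bA bB AB; have [fA fB] := (ball_finite bb bA, ball_finite bb bB).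
have [|A' [bA' AA' ge2 le]] := db bA.
  apply: (@lt_le_trans _ _ (mu B * (2^-1)%:E)%E).
    by rewrite !rmeasE// -EFinM lte_fin; lra.
  apply: lee_wpmul2r; first by rewrite lee_fin invr_ge0.
  by apply: le_measure; rewrite ?inE//; exact: fB.1.
have fA' := ball_finite bb bA'; exists A'; split=> //.
  by rewrite -lee_fin EFinM -!rmeasE.
by rewrite -lee_fin EFinM -!rmeasE.
Qed.

(* Doubling a ball doubles its measure while dividing the density of [F] by at
   most [eta]; a ball of density above [eps] has measure below [rm F / eps], so
   the last one met in the chain has density between [eps] and [eps * eta]. *)
Lemma dense_superball (eps : R) F A0 B : 0 < eps -> finite_meas mu F -> Bs B ->
  2 * rm F <= eps * rm B -> Bs A0 -> eps * rm A0 < rm (F `&` A0) ->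
  exists A, [/\ Bs A, A0 `<=` A, eps * rm A < rm (F `&` A) &
    rm (F `&` A) <= eps * eta * rm A].
Proof.
move=> eps0 fF bB FB bA0 dA0.
have measA A : Bs A -> measurable A by move=> /(ball_meas bb).
have leF A : Bs A -> rm (F `&` A) <= rm F.
  move=> /measA mA; apply: (rmeas_le _ fF (@subIsetl _ _ _)).
  by apply: measurableI => //; exact: fF.1.
(* The exponent [n] bounds the number of doublings left: at [n = 0] no ball can have density above
   [eps], and each doubling lowers it by one. *)
suff [n] : exists n, rm F <= eps * 2 ^+ n * rm A0.
  elim: n A0 bA0 dA0 => [|n IH] A bA dA leFA.
    by have := leF _ bA; lra.
  have [small|big] := leP (rm (F `&` A)) (eps * eta * rm A).
    by exists A; split=> //; exact: subset_refl.
  have AB : 2 * rm A < rm B by have := leF _ bA; rewrite -(ltr_pM2l eps0); lra.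
  have [A' [bA' AA' ge2 le]] := doubling_ball bA bB AB.
  have mFA' : rm (F `&` A) <= rm (F `&` A').
    apply: rmeas_le; first by apply: measurableI; [exact: fF.1|exact: measA].
      by apply: finite_measI => //; exact: measA.
    by apply: setIS.
  have [||A2 [bA2 A'A2 ? ?]] := IH A' bA'.
  - by have := ler_wpM2l (ltW eps0) le; lra.
  - apply: le_trans leFA _; rewrite exprS.
    have p0 : 0 <= eps * 2 ^+ n by apply: mulr_ge0; [exact: ltW|exact: exprn_ge0].
    by have := ler_wpM2l p0 ge2; move: (2 ^+ n) => p; lra.
  by exists A2; split=> //; exact: subset_trans A'A2.
have A0gt : 0 < eps * rm A0 by apply: mulr_gt0 => //; exact: (ball_gt0 bb).
have x0 : 0 <= rm F / (eps * rm A0) by apply: divr_ge0; [exact: rmeas_ge0|exact: ltW].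
exists (Num.bound (rm F / (eps * rm A0))).
rewrite mulrAC mulrC -ler_pdivrMr// ltW//; apply: lt_le_trans (archi_boundP x0) _.
by rewrite -natrX ler_nat ltnW// ltn_expl.
Qed.

(** Nearly cover [B] intersected with [F] by dense balls, enlarge each by [dense_superball], then
    apply Vitali. The lower density bound on the disjoint selected balls controls the total measure
    of their hulls; the upper one later forces cores to meet. *)
Lemma calderon_zygmund (h : set T -> set T) (eps : R) B F (e : R) :
  (forall B, Bs B -> is_hull mu K Bs B (h B)) ->
  0 < eps < 1 -> 0 < e -> finite_meas mu F -> Bs B ->
  2 * rm F <= eps * rm B ->
  exists s, [/\ forall A, A \in s -> [/\ Bs A, rm A <= rm B, A `&` B !=set0 &
      rm (F `&` A) <= eps * eta * rm A],
    \sum_(A <- s) rm (h A) <= K / eps * rm F &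
    rm ((B `&` F) `\` \bigcup_(A in [set` s]) h A) <= e].
Proof.
move=> hh eps01 e0 fF bB FB; have [eps0 _] := andP eps01.
have mF := fF.1; have mB := ball_meas bb bB.
have fE : finite_meas mu (B `&` F) by rewrite setIC; exact: finite_measI.
have [s0 [bs0 ds0 cs0]] := dense_balls bb K0 fE eps01 e0.
have /choice[q hq] A : exists A', A \in s0 -> [/\ Bs A', A `<=` A',
    A `&` B !=set0, eps * rm A' < rm (F `&` A') & rm (F `&` A') <= eps * eta * rm A'].
  have [As|nAs] := boolP (A \in s0); last by exists A.
  have bA := bs0 _ As; have dA := ds0 _ As; have mA := ball_meas bb bA.
  have AB : A `&` B !=set0.
    apply: contrapT => /set0P/negP; rewrite negbK => /eqP AB.
    move: dA; rewrite setIAC (setIC B) AB set0I /rmeas measure0.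
    by have := mulr_gt0 eps0 (ball_gt0 bb bA); rewrite /rmeas /=; lra.
  have dFA : eps * rm A < rm (F `&` A).
    apply: lt_le_trans dA _; apply: rmeas_le.
    - by apply: measurableI => //; exact: fE.1.
    - exact: finite_measI.
    - by move=> x [[_ Fx] Ax].
  by have [A' [? ? ? ?]] := dense_superball eps0 fF bB FB bA dFA; exists A'.
have bs1 A : A \in map q s0 -> Bs A by move=> /mapP[A' /hq[? _ _ _ _] ->].
have [s [ss1 ds cs]] := vitali bb bs1 hh.
exists s; split.
- move=> A /ss1/mapP[A0 /hq[bq A0q [x [A0x Bx]] lo hi] ->]; split=> //.
    (* Density above [eps] and [2 * rm F <= eps * rm B] keep the measure of the enlarged ball at
       most [rm B]. *)
    have := rmeas_le (measurableI _ _ mF (ball_meas bb bq)) fF (@subIsetl _ _ _).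
    move=> leF; rewrite -(ler_pM2l eps0).
    by have := rmeas_ge0 mu F; lra.
  by exists x; split=> //; exact: A0q.
- apply: (@le_trans _ _ (K / eps * \sum_(A <- s) rm (F `&` A))); last first.
    rewrite ler_pM2l ?divr_gt0//; apply: sum_disjoint_le => //.
    by move=> A /ss1/bs1/(ball_meas bb).
  rewrite mulr_sumr !big_seq; apply: ler_sum => A /ss1 As.
  have [_ _ leK] := hh _ (bs1 _ As).
  have [A0 /hq[_ _ _ lo _] eqA] := mapP As.
  apply: le_trans leK _; rewrite -mulrA ler_pM2l// ler_pdivlMl//.
  by rewrite eqA ltW.
apply: le_trans cs0; apply: rmeas_le.
- apply: measurableD; first exact: fE.1.
  apply: fin_bigcup_measurable; first exact: finite_seq.
  by move=> A /= /ss1/bs1/hh[/(ball_meas bb)].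
- apply: finite_measD => //.
  apply: fin_bigcup_measurable; first exact: finite_seq.
  by move=> A /= /bs0/(ball_meas bb).
move=> x [Ex nx]; split=> // -[A /= As Ax]; apply: nx; apply: cs.
by exists (q A); [exact: map_f|have [_ + _ _ _] := hq _ As; exact].
Qed.

(** The null set [Z] turns the essential infimum into a pointwise bound. Since [x] ranges over all
    of [H] and not only over [E], one value [g x] can control the cores of several balls containing
    [x]. *)
Definition osc_core (a b : R) (f g : T -> R) H E := [/\ measurable E, E `<=` H,
  a * rm H <= rm E & exists2 Z, (measurable Z /\ mu Z = 0%E) &
  forall x y z, H x -> ~ Z x -> E y -> E z -> `|f y - f z| <= b * `|g x|].

(** The domination inequality is strict, so some set admissible in the infimum [OSC_ball] already
    oscillates less than its right-hand side. *)
Lemma dominated_core beta f g a B : strongly_dominated mu Bs beta f g ->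
  0 < a < 1 -> Bs B -> exists E, osc_core a (beta a) f g B E.
Proof.
move=> sd a01 bB; have [b0 osc] := sd a a01.
have mB := ball_meas bb bB; have fB := ball_finite bb bB.
have /ereal_inf_lt[_ [E [mE EB aE] <-] ltE] := osc B mB bB.
have fE := finite_meas_sub mE fB EB.
exists E; split=> //; first by rewrite -lee_fin EFinM -!rmeasE.
have [Z [mZ Z0 sZ]] := ess_inf_le (mrestr mu mB) (fun y => `|g y|%:E).
(* [Z] is null only for the restriction of [mu] to [B]. *)
exists (Z `&` B); first by split; [exact: measurableI|exact: Z0].
move=> x y z Bx nZ Ey Ez; rewrite -lee_fin.
have osc_yz : (`|f y - f z|%:E <= OSC E f)%E.
  by apply: ereal_sup_ubound; exists (y, z).
apply: le_trans (le_trans osc_yz (ltW ltE)) _.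
rewrite EFinM; apply: lee_wpmul2l; first by rewrite lee_fin ltW.
by apply: contrapT => nle; apply: nZ; split=> //; exact: sZ.
Qed.

End Selection.

Lemma measurable_lt_set {R : realType} d (T : measurableType d) (u v : T -> R) :
  measurable_fun setT u -> measurable_fun setT v ->
  measurable [set x | u x < v x].
Proof.
move=> mu mv; rewrite -preimage_true -[X in measurable X]setTI.
exact: (measurable_fun_ltr mu mv).
Qed.

(** * Iterated decay of the exceptional sets, and passage to the median *)

Section Iteration.
Context {R : realType} {d : measure_display} {T : measurableType d}.
Variables (mu : {measure set T -> \bar R}) (K eta : R) (Bs : set (set T)).
Hypotheses (bb : ball_basis mu K Bs) (db : doubling mu eta Bs).
Hypothesis K0 : 0 < K.
Variables (f g : T -> R) (a b eps : R) (h : set T -> set T) (core : set T -> set T).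
Hypotheses (hh : forall B, Bs B -> is_hull mu K Bs B (h B)).
Hypotheses (corP : forall B, Bs B -> osc_core mu a b f g B (core B)).
Hypotheses (b0 : 0 < b) (eps01 : 0 < eps < 1) (eps_eta : eps * eta <= 4^-1).
Hypotheses (aK1 : 2 * ((1 - a) * K) <= eps) (aK2 : 4 * ((1 - a) * K ^+ 2) <= eps).
Hypotheses (a1 : a < 1).
Local Notation rm := (rmeas mu).
Implicit Types (A B E F G H : set T) (s : seq (set T)).

Let bfin := ball_finite bb.
Let bmeas := ball_meas bb.

Lemma hull_ball B : Bs B -> Bs (h B).
Proof. by move=> /hh[]. Qed.

Lemma core_meas B : Bs B -> measurable (core B).
Proof. by move=> /corP[]. Qed.

Lemma core_compl B : Bs B -> rm (B `\` core B) <= (1 - a) * rm B.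
Proof.
move=> bB; have [mE EB aE _] := corP bB.
by have := rmeasDI (bfin bB) mE; rewrite (setIidr EB); lra.
Qed.

(** Were the cores disjoint, every point of [A] would miss one of them. The points missing the first
    have measure at most [rm A / 4], those missing the second at most [(1 - a) * K ^+ 2 * rm A],
    which is below [rm A / 4]. *)
Lemma meet_cores B A : Bs B -> Bs A -> A `<=` h B ->
  rm ((h B `\` core (h B)) `&` A) <= eps * eta * rm A ->
  (core (h B) `&` core (h (h A))) !=set0.
Proof.
move=> bB bA AhB small; apply: contrapT => /set0P/negP; rewrite negbK => /eqP dis.
have bhB := hull_ball bB; have bhA := hull_ball bA; have bhhA := hull_ball bhA.
have A0 := ball_gt0 bb bA.
have fL : finite_meas mu ((h B `\` core (h B)) `&` A).
  by apply: finite_measI; [apply: finite_measD; [exact: bfin|exact: core_meas]|exact: bmeas].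
have fR : finite_meas mu (h (h A) `\` core (h (h A))).
  by apply: finite_measD; [exact: bfin|exact: core_meas].
have [fU leU] := finite_measU fL fR.
have sub : A `<=` ((h B `\` core (h B)) `&` A) `|` (h (h A) `\` core (h (h A))).
  move=> x Ax; have [cx|nx] := pselect (core (h B) x).
    right; split.
      by apply: (hull_sub bb bhA (hh bhA)); apply: (hull_sub bb bA (hh bA)).
    by move=> cx'; have : (core (h B) `&` core (h (h A))) x by []; rewrite dis.
  by left; split=> //; split=> //; exact: AhB.
have leA := le_trans (rmeas_le (bmeas bA) fU sub) leU.
have le2 := core_compl bhhA.
have [_ _ hA] := hh bA; have [_ _ hhA] := hh bhA.
have le3 : (1 - a) * rm (h (h A)) <= (1 - a) * K ^+ 2 * rm A.
  rewrite -mulrA ler_wpM2l ?subr_ge0 ?(ltW a1)//.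
  by apply: le_trans hhA _; rewrite expr2 -mulrA ler_pM2l.
have le4 := ler_wpM2r (ltW A0) eps_eta.
have le5 := ler_wpM2r (ltW A0) aK2.
have [_ eps1] := andP eps01.
have le6 : eps * rm A < rm A by rewrite gtr_pMl.
lra.
Qed.

(* Each step passes to the hulls of the Calderon-Zygmund balls; a point common
   to the cores of two consecutive hulls transfers the estimate at the cost of
   one more [b * `|g x|], since [g x] bounds the oscillation on every core of a
   ball containing [x]. *)
Lemma oscillation_decay n B : Bs B -> exists G, [/\ finite_meas mu G,
  rm G <= 2^-1 ^+ n * rm B &
  forall x y, B x -> ~ G x -> core (h B) y -> `|f x - f y| <= b * n%:R * `|g x|].
Proof.
elim: n B => [|n IH] B bB.
  by exists B; split; [exact: bfin|rewrite expr0 mul1r|].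
have /choice[Gf Gfp] A : exists G, Bs A -> [/\ finite_meas mu G,
    rm G <= 2^-1 ^+ n * rm A &
    forall x y, A x -> ~ G x -> core (h A) y -> `|f x - f y| <= b * n%:R * `|g x|].
  by have [/IH[G ?]|nA] := pselect (Bs A); [exists G|exists A].
have bH := hull_ball bB; have B0 := ball_gt0 bb bB.
pose F := h B `\` core (h B).
have fF : finite_meas mu F by apply: finite_measD; [exact: bfin|exact: core_meas].
have leF : rm F <= (1 - a) * K * rm B.
  apply: le_trans (core_compl bH) _; rewrite -mulrA ler_wpM2l ?subr_ge0 ?(ltW a1)//.
  by have [_ _] := hh bB.
have FB : 2 * rm F <= eps * rm B by have := ler_wpM2r (ltW B0) aK1; lra.
pose p : R := 2^-1 ^+ n; have p0 : 0 < p by apply: exprn_gt0; rewrite invr_gt0.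
(* The measure allowed is [p * rm B / 2]: one half for what the hulls miss, the other for the
   exceptional sets of the hulls. *)
have e0 : 0 < p * (4^-1 * rm B) by rewrite !mulr_gt0// invr_gt0.
have [s [sP sumP covP]] := calderon_zygmund bb db K0 hh eps01 e0 fF bB FB.
have [_ _ _ [Z [mZ Z0] oscZ]] := corP bH.
have bs A : A \in s -> Bs A by move=> /sP[].
pose C := \bigcup_(A in [set` s]) h A.
have mC : measurable C.
  apply: fin_bigcup_measurable; first exact: finite_seq.
  by move=> A /= /bs/hull_ball/bmeas.
have fZ : finite_meas mu Z by split=> //; rewrite Z0.
have rZ : rm Z = 0 by rewrite /rmeas Z0.
have fL : finite_meas mu ((B `&` F) `\` C).
  by apply: finite_measD => //; apply: finite_measI; [exact: bfin|exact: fF.1].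
have /finite_meas_bigcup[fG leG] : forall A, A \in s -> finite_meas mu (Gf (h A)).
  by move=> A /bs/hull_ball/Gfp[].
have [fZL leZL] := finite_measU fZ fL.
have [fU leU] := finite_measU fZL fG.
exists ((Z `|` ((B `&` F) `\` C)) `|` \bigcup_(A in [set` s]) Gf (h A)).
split=> //.
  have leS : \sum_(A <- s) rm (Gf (h A)) <= p * (4^-1 * rm B).
    apply: (@le_trans _ _ (p * \sum_(A <- s) rm (h A))).
      rewrite mulr_sumr !big_seq; apply: ler_sum => A /bs/hull_ball/Gfp[_ + _].
      by [].
    rewrite ler_pM2l//; apply: le_trans sumP _.
    have [e00 _] := andP eps01.
    apply: (@le_trans _ _ (K / eps * ((1 - a) * K * rm B))).
      by rewrite ler_pM2l// divr_gt0.
    have -> : K / eps * ((1 - a) * K * rm B) = (1 - a) * K ^+ 2 / eps * rm B.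
      by field; rewrite gt_eqF.
    by rewrite ler_pM2r// ler_pdivrMr//; have := aK2; lra.
  by rewrite exprS -/p; lra.
move=> x y Bx nG Ey; have Hx := hull_sub bb bB (hh bB) Bx.
have nZ : ~ Z x by move=> Zx; apply: nG; left; left.
have g0 : 0 <= b * `|g x| by rewrite mulr_ge0// ltW.
have n0 : 0 <= b * n%:R * `|g x| by rewrite !mulr_ge0// ltW.
have -> : b * n.+1%:R * `|g x| = b * n%:R * `|g x| + b * `|g x|.
  by rewrite -natr1; ring.
have [Ex|nEx] := pselect (core (h B) x).
  by have := oscZ x x y Hx nZ Ex Ey; lra.
(* Off the core, [x] lies in [F], hence in one of the hulls unless it is in the exceptional set. *)
have [[A /= As hAx]|nC] := pselect (C x); last first.
  by exfalso; apply: nG; left; right; split=> //; split.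
have [bA leAB AB smallA] := sP _ As.
have AH : A `<=` h B by have [_ + _] := hh bB; apply=> //; lra.
have [q [Eq Eq']] := meet_cores bB bA AH smallA.
have [_ _ Gp] := Gfp _ (hull_ball bA).
have lexq : `|f x - f q| <= b * n%:R * `|g x|.
  by apply: Gp => // Gx; apply: nG; right; exists A.
have leqy := oscZ x q y Hx nZ Eq Ey.
apply: le_trans (ler_distD (f q) _ _) _.
by apply: lerD.
Qed.

(** The core fills more than half of [B], so it lies neither in [f > m] nor in [f < m]. It thus has
    values of [f] on both sides of [m], all within [x] of [f p]. *)
Lemma median_core B (m x : R) (p : T) : is_median mu f B m -> measurable_fun setT f ->
  Bs B -> 2^-1 < a -> core B p ->
  (forall y z, core B y -> core B z -> `|f y - f z| <= x) -> `|f p - m| <= x.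
Proof.
move=> [hi lo] mf bB a2 Ep osc; have [mE EB aE _] := corP bB.
have B0 := ball_gt0 bb bB.
have half S : measurable S -> (mu (B `&` S) <= mu B * (2^-1)%:E)%E ->
    ~ (core B `<=` S).
  move=> mS; have fBS := finite_measI (bfin bB) mS.
  rewrite !rmeasE//; last exact: bfin.
  rewrite -EFinM lee_fin => leS ES.
  have : rm (core B) <= rm (B `&` S).
    by apply: rmeas_le => // y Ey; split; [exact: EB|exact: ES].
  have : 2^-1 * rm B < a * rm B by rewrite ltr_pM2r.
  lra.
have mhi : measurable [set y | m < f y].
  by apply: measurable_lt_set => //; exact: measurable_cst.
have mlo : measurable [set y | f y < m].
  by apply: measurable_lt_set => //; exact: measurable_cst.
have [q [Eq fq]] : exists q, core B q /\ f q <= m.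
  apply: contrapT => nq; apply: (half _ mhi hi) => y Ey /=.
  by rewrite ltNge; apply/negP => le; apply: nq; exists y.
have [q' [Eq' fq']] : exists q, core B q /\ m <= f q.
  apply: contrapT => nq; apply: (half _ mlo lo) => y Ey /=.
  by rewrite ltNge; apply/negP => le; apply: nq; exists y.
have := osc _ _ Ep Eq; have := osc _ _ Ep Eq'.
by rewrite !ler_norml => /andP[? ?] /andP[? ?]; apply/andP; split; lra.
Qed.

(** The cores of [B] and [h B] omit at most [(1 - a) * (1 + K) * rm B] of [B], so they share a point
    [p]. Comparing [f p] with the median costs one more [b * |g x|], hence [n.+1]. *)
Lemma median_decay n B (m : R) : Bs B -> is_median mu f B m -> measurable_fun setT f ->
  2^-1 < a -> (1 - a) * (1 + K) < 1 ->
  exists G, [/\ finite_meas mu G, rm G <= 2^-1 ^+ n * rm B &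
  forall x, B x -> ~ G x -> `|f x - m| <= b * n.+1%:R * `|g x|].
Proof.
move=> bB med mf a2 aK; have [G [fG leG oscG]] := oscillation_decay n bB.
have [_ _ _ [Z [mZ Z0] oscZ]] := corP bB.
have fZ : finite_meas mu Z by split=> //; rewrite Z0.
have rZ : rm Z = 0 by rewrite /rmeas Z0.
have [fGZ leGZ] := finite_measU fG fZ.
exists (G `|` Z); split=> //; first by lra.
have bH := hull_ball bB; have B0 := ball_gt0 bb bB.
have [p [Ep EHp]] : (core B `&` core (h B)) !=set0.
  apply: contrapT => /set0P/negP; rewrite negbK => /eqP dis.
  have fL : finite_meas mu (B `\` core B).
    by apply: finite_measD; [exact: bfin|exact: core_meas].
  have fR : finite_meas mu (h B `\` core (h B)).
    by apply: finite_measD; [exact: bfin|exact: core_meas].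
  have [fU leU] := finite_measU fL fR.
  have sub : B `<=` (B `\` core B) `|` (h B `\` core (h B)).
    move=> x Bx; have [cx|nx] := pselect (core B x); last by left.
    right; split; first exact: (hull_sub bb bB (hh bB)).
    by move=> cx'; have : (core B `&` core (h B)) x by []; rewrite dis.
  have := rmeas_le (bmeas bB) fU sub.
  have := core_compl bB; have := core_compl bH; have [_ _ hB] := hh bB.
  have a1' : 0 <= 1 - a by rewrite subr_ge0 ltW.
  have := ler_wpM2l a1' hB.
  have : (1 - a) * (1 + K) * rm B < rm B by rewrite gtr_pMl.
  lra.
move=> x Bx nGZ; have nG : ~ G x by move=> ?; apply: nGZ; left.
have nZ : ~ Z x by move=> ?; apply: nGZ; right.
have := median_core med mf bB a2 Ep (fun y z => oscZ x y z Bx nZ).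
have := oscG x p Bx nG EHp => le1 le2.
apply: le_trans (ler_distD (f p) _ _) _.
by rewrite -natr1 mulrDr mulrDl mulr1 lerD.
Qed.

End Iteration.

(** * From geometric to exponential decay *)

Section ExponentialDecay.
Context {R : realType}.

Lemma natr_half_expR (n : nat) : 2^-1 ^+ n = expR (- (n%:R * ln 2)) :> R.
Proof.
have ln2 : 2 \is @Num.pos R by rewrite posrE.
by rewrite -mulrN expRM_natl expRN lnK.
Qed.

(* [n - 1] steps of the iteration are available at level [lambda >= b * n], and
   [lambda < b * (n + 1)] for [n] the integer part of [lambda / b]. *)
Lemma expR_decay (phi : R -> R) (b V : R) : 0 < b -> 0 <= V ->
  (forall t, phi t <= V) ->
  (forall n t, b * n.+1%:R <= t -> phi t <= 2^-1 ^+ n * V) ->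
  forall t, 0 < t -> phi t <= 4 * expR (- (ln 2 / b * t)) * V.
Proof.
move=> b0 V0 phiV phin t t0; pose n := Num.truncn (t / b).
have tb0 : 0 <= t / b by rewrite divr_ge0 ?ltW.
have /andP[len ltn] := truncn_itv tb0.
have le2 : phi t <= 2 * 2^-1 ^+ n * V.
  have [n0|n0] := posnP n.
    rewrite n0 expr0 mulr1; apply: le_trans (phiV t) _; lra.
  have := phin n.-1 t; rewrite prednK// => /(_ _)/le_trans; apply.
    by rewrite mulrC -ler_pdivlMr.
  apply: ler_wpM2r => //; rewrite -[in leRHS](prednK n0) exprS mulrA divff ?mul1r//.
apply: le_trans le2 _; apply: ler_wpM2r => //.
(* The constant 4 arises here: the exponent [n.+1] is needed because it exceeds [t / b]. *)
apply: (@le_trans _ _ (4 * 2^-1 ^+ n.+1)); first by rewrite exprS; lra.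
rewrite ler_pM2l// natr_half_expR ler_expR lerN2.
rewrite mulrAC -mulrA [leRHS]mulrC ler_wpM2l//; last exact: ltW.
by apply: ln_ge0; lra.
Qed.
End ExponentialDecay.

(** [eps] is fixed by [eps * eta = 1/4], and then [1 - a = eps * r], where [r] is small enough that
    [r * K], [r * K ^+ 2] and [r * (1 + K)] are all at most [1/4]. *)
Lemma core_density_bounds (R : realType) (K eta : R) : 0 < K -> 2 < eta ->
  let eps := (4 * eta)^-1 in let a := 1 - eps / (4 * (K + 1) ^+ 2) in
  [/\ 0 < eps < 1, eps * eta <= 4^-1, 2 * ((1 - a) * K) <= eps &
    4 * ((1 - a) * K ^+ 2) <= eps] /\
  [/\ 2^-1 < a, a < 1 & (1 - a) * (1 + K) < 1].
Proof.
move=> K0 eta2 eps a.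
have e0 : 0 < eps by rewrite invr_gt0; lra.
have ee : eps * eta = 4^-1 by rewrite /eps; field; lra.
have e8 : eps * 8 < 1.
  have : eps * 2 < eps * eta by rewrite ltr_pM2l.
  lra.
pose r := (4 * (K + 1) ^+ 2)^-1.
have r0 : 0 < r by rewrite invr_gt0 mulr_gt0// exprn_gt0//; lra.
have r1 : r * (K + 1) ^+ 2 = 4^-1 by rewrite /r; field; lra.
have rK2 : r * K ^+ 2 <= 4^-1.
  by rewrite -r1 ler_pM2l// ler_sqr ?nnegrE; lra.
have rK1 : r * (1 + K) <= 4^-1.
  by rewrite -r1 ler_pM2l// expr2; have := mulr_gt0 K0 K0; lra.
have rK : r * K <= 4^-1 by lra.
have aE : 1 - a = eps * r by rewrite /a subKr.
have er : eps * r < 2^-1.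
  have r4 : r <= 4^-1.
    by have := mulr_gt0 r0 K0; lra.
  have : eps * r <= 1 * 4^-1 by apply: ler_pM => //; lra.
  lra.
rewrite aE -!mulrA; split; split; rewrite ?ee//.
- by apply/andP; split; lra.
- by have := ler_wpM2l (ltW e0) rK; lra.
- by have := ler_wpM2l (ltW e0) rK2; lra.
- by lra.
- by have := mulr_gt0 e0 r0; lra.
- by have := ler_wpM2l (ltW e0) rK1; lra.
Qed.

(** * The exponential estimate *)

Local Open Scope ereal_scope.

Theorem theorem1p2 (R : realType) (K eta : R) (hK : (0 < K)%R)
    (heta : (2 < eta)%R) :
  exists C : R, (0 < C)%R /\
  forall beta : R -> R, exists c : R, (0 < c)%R /\
  forall (d : measure_display) (T : measurableType d)
    (mu : {measure set T -> \bar R}) (Bs : set (set T)),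
    ball_basis mu K Bs -> doubling mu eta Bs ->
  forall f g : T -> R,
    measurable_fun setT f -> measurable_fun setT g ->
    strongly_dominated mu Bs beta f g ->
  forall (B : set T) (m : R), Bs B -> is_median mu f B m ->
  forall lambda : R, (0 < lambda)%R ->
    mu [set x | B x /\ (lambda * `|g x| < `|f x - m|)%R]
      <= (C * expR (- (c * lambda)))%:E * mu B.
Proof.
have [[eps01 eps_eta aK1 aK2] [a2 a1 aK]] := core_density_bounds hK heta.
set eps := ((4 * eta)^-1)%R in eps01 eps_eta aK1 aK2 a2 a1 aK.
set a := (1 - eps / (4 * (K + 1) ^+ 2))%R in aK1 aK2 a2 a1 aK.
have a01 : (0 < a < 1)%R by apply/andP; split; lra.
exists 4%R; split=> // beta.
have ln2 : (0 < ln 2 :> R)%R by apply: ln_gt0; lra.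
(* The rate is chosen before any domination is assumed, so [beta a] may fail to be positive; then
   nothing is dominated with this [beta] and any rate works. *)
have [b0|nb0] := ltP 0%R (beta a); last first.
  exists 1%R; split=> // d T mu Bs _ _ f g _ _ sd.
  by have [] := sd a a01; rewrite ltNge nb0.
exists (ln 2 / beta a)%R; split; first exact: divr_gt0.
move=> d T mu Bs bb db f g mf mg sd B m bB med.
have [h hh] := hull_exists bb.
have /choice[core corP] A : exists E, Bs A -> osc_core mu a (beta a) f g A E.
  have [bA|nA] := pselect (Bs A); last by exists A.
  by have [E] := dominated_core bb sd a01 bA; exists E.
have fB := ball_finite bb bB.
pose S t := [set x | B x /\ (t * `|g x| < `|f x - m|)%R].
have mS t : measurable (S t).
  apply: measurableI; first exact: fB.1.
  apply: measurable_lt_set.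
    by apply: measurable_funM => //; exact: measurableT_comp.
  by apply: measurableT_comp => //; exact: measurable_funB.
have SB t : S t `<=` B by move=> x [].
move=> lambda l0; have fS := finite_meas_sub (mS lambda) fB (SB lambda).
rewrite -/(S lambda) !rmeasE// -EFinM lee_fin.
apply: (expR_decay (phi := fun t => rmeas mu (S t))) => //.
- exact: rmeas_ge0.
- by move=> t; apply: rmeas_le.
move=> n t bt.
have [G [fG leG oscG]] := median_decay bb db hK hh corP b0 eps01 eps_eta aK1 aK2
  a1 n bB med mf a2 aK.
apply: le_trans leG; apply: rmeas_le => // x [Bx ltx].
(* Since [t] is at least [beta a * n.+1], a point of [S t] outside [G] would violate the bound of
   [median_decay]. *)
apply: contrapT => nGx; have := oscG x Bx nGx; rewrite leNgt => /negP; apply.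
by apply: le_lt_trans ltx; apply: ler_wpM2r.
Qed.
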